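(* Let $L=\mathfrak{sl}_2(\mathbb{F}_q)$ with $q$ odd, and let $\Gamma(L)$ be its comaximal graph. Then: (1) $\Gamma(L)$ is connected. (2) The girth of $\Gamma(L)$ is $3$. (3) The clique number is $\omega(\Gamma(L))=\frac{q^2+q+2}{2}$. (4) The diameter of $\Gamma(L)$ is $2$. (5) The domination number is $\gamma(\Gamma(L))=1$. (6) Every vertex of $\Gamma(L)$ lies on a triangle. (7) $\Gamma(L)$ is non-planar. (8) The radius is $r(\Gamma(L))=1$. Moreover, the center of $\Gamma(L)$ is the set of all nonsplit semisimple lines.
   Context: The comaximal graph $\Gamma(L)$ of a finite-dimensional Lie algebra $L$ is the simple undirected graph whose vertices are the nonzero proper Lie subalgebras of $L$, two distinct vertices $A,B$ being adjacent if and only if $\langle A,B\rangle=L$, where $\langle A,B\rangle$ denotes the Lie subalgebra generated by $A\cup B$. A line (one-dimensional subalgebra) of $\mathfrak{sl}_2(\mathbb{F}_q)$ spanned by a nonzero matrix $u$ is nonsplit semisimple if the characteristic polynomial of $u$ has no root in $\mathbb{F}_q$. The domination number is the least size of a set $S$ of vertices such that every vertex not in $S$ is adjacent to some vertex in $S$. The eccentricity of a vertex is its maximum distance to another vertex; the radius is the minimum eccentricity, and the center is the set of vertices of minimum eccentricity. *)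

(* Defs.v *)
From HB Require Import structures.
From mathcomp Require Import all_boot all_order all_algebra all_field.
From mathcomp Require Import classical_sets reals topology normedtype.

Set Implicit Arguments.
Unset Strict Implicit.
Unset Printing Implicit Defensive.

Import Order.TTheory GRing.Theory Num.Theory.
Import numFieldNormedType.Exports.

Local Open Scope ring_scope.

HB.instance Definition _ (F : finFieldType) (vT : vectType F) :
    isCountable {vspace vT} :=
  CanIsCountable (@VectorInternalTheory.vs2mxK F vT).
HB.instance Definition _ (F : finFieldType) (vT : vectType F) :
    isFinite {vspace vT} :=
  CanIsFinite (@VectorInternalTheory.vs2mxK F vT).

(** * Linear Lie algebras over a finite field

    The ambient Lie algebra is gl_n(F), i.e. all n x n matrices with the
    commutator bracket; [L], [U] are Lie algebras of matrices inside it. *)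

Definition lie_bracket (F : fieldType) (n : nat) (A B : 'M[F]_n) : 'M[F]_n :=
  A *m B - B *m A.

(* The codomain is F^o because F itself carries no F-module structure. *)
Definition sl (F : fieldType) (n : nat) : {vspace 'M[F]_n} :=
  lker (linfun (mxtrace : 'M[F]_n -> F^o)).

Lemma mem_sl (F : fieldType) (n : nat) (A : 'M[F]_n) :
  (A \in sl F n) = (\tr A == 0).
Proof. by rewrite memv_ker lfunE. Qed.

Section Comaximal.
Variables (F : finFieldType) (n : nat) (L : {vspace 'M[F]_n}).

Definition lie_subalgebra (U : {vspace 'M[F]_n}) : bool :=
  (U <= L)%VS &&
  [forall A : 'M[F]_n, forall B : 'M[F]_n,
     (A \in U) ==> (B \in U) ==> (lie_bracket A B \in U)].

(* For U, V inside a Lie algebra L, the family contains L itself, so the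
   intersection is never the empty one. *)
Definition lie_generated (U V : {vspace 'M[F]_n}) : {vspace 'M[F]_n} :=
  (\bigcap_(W : {vspace 'M[F]_n} |
      [&& lie_subalgebra W, (U <= W)%VS & (V <= W)%VS]) W)%VS.

Definition proper_subalgebra (U : {vspace 'M[F]_n}) : bool :=
  [&& lie_subalgebra U, U != 0%VS & U != L].

Definition comaximal_vertex : finType :=
  {U : {vspace 'M[F]_n} | proper_subalgebra U}.

Definition comaximal : rel comaximal_vertex :=
  fun U V => (U != V) && (lie_generated (val U) (val V) == L).

End Comaximal.

Lemma sl_lie_subalgebra (F : finFieldType) (n : nat) :
  lie_subalgebra (sl F n) (sl F n).
Proof.
rewrite /lie_subalgebra subvv; apply/forallP => A; apply/forallP => B.
apply/implyP => _; apply/implyP => _.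
by rewrite mem_sl /lie_bracket raddfB /= mxtrace_mulC subrr.
Qed.

Lemma comaximal_irr (F : finFieldType) (n : nat) (L : {vspace 'M[F]_n}) :
  irreflexive (comaximal (L := L)).
Proof. by move=> U; rewrite /comaximal eqxx. Qed.

Lemma comaximal_sym (F : finFieldType) (n : nat) (L : {vspace 'M[F]_n}) :
  symmetric (comaximal (L := L)).
Proof.
move=> U V; rewrite /comaximal eq_sym; congr (_ && (_ == _)).
by apply: eq_bigl => W; rewrite [(val U <= W)%VS && _]andbC.
Qed.

Definition nonsplit_semisimple_line (F : finFieldType) (n : nat)
    (U : {vspace 'M[F]_n}) : bool :=
  [exists u : 'M[F]_n, [&& u != 0, U == <[u]>%VS &
    [forall a : F, ~~ root (char_poly u) a]]].

(** * Finite simple graphs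

    A graph on a finite type of vertices is an irreflexive symmetric
    relation [e]. *)

Section Graph.
Variables (T : finType) (e : rel T).

Definition graph_connected : Prop := forall x y : T, connect e x y.

Definition has_walk (x y : T) (k : nat) : bool :=
  [exists p : k.-tuple T, path e x p && (last x p == y)].

(* Distances between vertices joined by a walk are < #|T|; the value #|T|
   stands for an infinite distance. *)
Definition graph_dist (x y : T) : nat := find (has_walk x y) (iota 0 #|T|).

Definition graph_eccentricity (x : T) : nat := \max_(y : T) graph_dist x y.

Definition graph_diameter : nat := \max_(x : T) graph_eccentricity x.

(* An eccentricity never exceeds #|T|, so this is the minimum as soon as T is
   inhabited. *)
Definition graph_radius : nat := \big[minn/#|T|]_(x : T) graph_eccentricity x.

Definition graph_center : {set T} := [set x | graph_eccentricity x == graph_radius].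

Definition has_cycle (k : nat) : bool :=
  (2 < k)%N && [exists p : k.-tuple T, ucycleb e p].

(* The value #|T|.+1 stands for the infinite girth of an acyclic graph. *)
Definition graph_girth : nat := find has_cycle (iota 0 #|T|.+1).

Definition clique (S : {set T}) : bool :=
  [forall x in S, forall y in S, (x != y) ==> e x y].

Definition clique_number : nat := \max_(S : {set T} | clique S) #|S|.

Definition dominating (S : {set T}) : bool :=
  [forall x, (x \notin S) ==> [exists y in S, e x y]].

(* The default #|T| is the size of the dominating set [set: T]. *)
Definition domination_number : nat :=
  \big[minn/#|T|]_(S : {set T} | dominating S) #|S|.

(* The graph being irreflexive, x, y and z are pairwise distinct. *)
Definition on_triangle (x : T) : Prop :=
  exists y z : T, [/\ e x y, e y z & e z x].

(* A drawing in the plane R x R: vertices are distinct points [pt x], and an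
   edge xy is a simple (injective, continuous) arc parametrised by [0, 1];
   [arc y x] is the same arc run backwards. *)
Definition planar_drawing (R : realType)
    (pt : T -> R * R) (arc : T -> T -> R -> R * R) : Prop :=
  [/\ injective pt,
      forall x y, e x y ->
        [/\ {within `[0, 1], continuous (arc x y)}%classic,
            {in `[0, 1]%R &, injective (arc x y)},
            arc x y 0 = pt x,
            arc x y 1 = pt y &
            {in `[0, 1]%R, forall t, arc y x t = arc x y (1 - t)}],
      forall x y z (t : R), e x y -> t \in `]0, 1[%R -> arc x y t <> pt z &
      forall x y x' y' (s t : R),
        e x y -> e x' y' -> [set x; y] != [set x'; y'] ->
        s \in `]0, 1[%R -> t \in `]0, 1[%R -> arc x y s <> arc x' y' t].

Definition planar (R : realType) : Prop :=
  exists (pt : T -> R * R) (arc : T -> T -> R -> R * R), planar_drawing pt arc.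

End Graph.

(* Main.v *)
(** For a nilpotent n, the plane n^⊥ in sl_2 for the trace form is a Borel
    subalgebra.  If u, v, w are in a subalgebra U with tr([u,v]w) <> 0, then U is
    everything; so in a proper U containing independent u and v, the bracket
    n = [u,v] is isotropic, hence nilpotent, and U lies in n^⊥.  A line <u> lies in
    some n^⊥ exactly when u has an eigenvalue in F.  Thus every vertex is either a
    nonsplit line or contained in a Borel, and two distinct vertices are adjacent
    iff no Borel contains both.  The Borels are indexed by the q + 1 nilpotent
    lines, and the nonsplit lines, spanned by [[a,1],[d-a^2,-a]] with d a nonsquare,
    number q(q-1)/2.  All the graph invariants follow; a maximum clique consists of
    the nonsplit lines and the nilpotent lines.

    Since the graph contains K_5, non-planarity is the van Kampen-Hanani-Tutte
    parity argument: in a polygonal drawing of K_5 in general position the number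
    of crossings between disjoint edges is odd.  Disjoint edges of a continuous
    planar drawing are at positive distance, so fine enough polygonal
    approximations, perturbed into general position, have no such crossing; edges
    that share an endpoint may cross, which is harmless. *)

Require Import Defs.
From HB Require Import structures.
From mathcomp Require Import all_boot all_order all_algebra all_fingroup.
From mathcomp Require Import all_solvable all_field.
From mathcomp Require Import classical_sets reals topology normedtype.
From mathcomp Require Import prodnormedzmodule filter.

Set Implicit Arguments.
Unset Strict Implicit.
Unset Printing Implicit Defensive.

(** * Crossing parity *)

Section Chirotope.
Variables (I : eqType) (o : I -> I -> I -> bool).

(* [o i j k] stands for "the triangle i, j, k is counterclockwise"; the last
   clause is the sign form of the three-term Grassmann-Pluecker relation
   [abc][ade] - [abd][ace] + [abe][acd] = 0. *)
Definition chirotope : Prop :=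
  [/\ forall i j k, o j k i = o i j k,
      forall i j k, uniq [:: i; j; k] -> o i k j = ~~ o i j k &
      forall a b c d e, uniq [:: a; b; c; d; e] ->
        (o a b c (+) o a d e (+) (o a b e (+) o a c d))
          || ~~ (o a b d (+) o a c e (+) (o a b c (+) o a d e))].

(** Proper crossing of the segments [ab] and [cd]: the line through either one separates the ends of
    the other. *)
Definition crosses a b c d := (o a b c (+) o a b d) && (o c d a (+) o c d b).

(** The point [d] is on the same side of the three directed edges; the triangle itself may have
    either orientation. *)
Definition in_triangle a b c d :=
  ~~ (o a b d (+) o b c d) && ~~ (o b c d (+) o c a d).

Hypothesis oP : chirotope.

Ltac uniq_tac :=
  by rewrite /= ?inE ?negb_or; do ?(apply/andP; split) => //; rewrite eq_sym.

Lemma chirotope_perm i j k : uniq [:: i; j; k] ->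
  ((o j k i = o i j k) * (o k i j = o i j k) * (o i k j = ~~ o i j k) *
   (o k j i = ~~ o i j k) * (o j i k = ~~ o i j k))%type.
Proof.
case: oP => cyc alt _ u; have kj := alt _ _ _ u.
by do !split; rewrite ?(cyc k j i) ?(cyc i k j) ?(cyc j k i) ?(cyc i j k).
Qed.

Lemma chirotope_gp a b c d e : uniq [:: a; b; c; d; e] ->
  (o a b c (+) o a d e (+) (o a b e (+) o a c d))
    || ~~ (o a b d (+) o a c e (+) (o a b c (+) o a d e)).
Proof. by case: oP => _ _; apply. Qed.

Ltac orient i j k :=
  let H := fresh in
  (have H : uniq [:: i; j; k] by uniq_tac);
  rewrite ?(chirotope_perm H); clear H.

(* The orientations of the ten triples of five points are ten booleans subject to
   five Grassmann-Pluecker relations: the identity is checked on all of them. *)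
Ltac distinct5 a b c d e u :=
  move: (u); rewrite /= !inE !negb_or;
  move=> /and5P[] /and4P[? ? ? ?] /and3P[? ? ?] /andP[? ?] ? _;
  have /(chirotope_gp) := u;
  (have /(chirotope_gp) : uniq [:: b; a; c; d; e] by uniq_tac);
  (have /(chirotope_gp) : uniq [:: c; a; b; d; e] by uniq_tac);
  (have /(chirotope_gp) : uniq [:: d; a; b; c; e] by uniq_tac);
  (have /(chirotope_gp) : uniq [:: e; a; b; c; d] by uniq_tac);
  orient a b c; orient a b d; orient a b e; orient a c d; orient a c e;
  orient a d e; orient b c d; orient b c e; orient b d e; orient c d e;
  case: (o a b c); case: (o a b d); case: (o a b e); case: (o a c d);
  case: (o a c e); case: (o a d e); case: (o b c d); case: (o b c e);
  case: (o b d e); case: (o c d e) => //=.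

(** The Jordan curve theorem mod 2 for a triangle and the segment [de]; polygons reduce to it
    through fans. *)
Lemma crosses_triangle a b c d e : uniq [:: a; b; c; d; e] ->
  crosses a b d e (+) crosses b c d e (+) crosses a c d e =
  in_triangle a b c d (+) in_triangle a b c e.
Proof.
move=> u; rewrite /crosses /in_triangle.
distinct5 a b c d e u.
Qed.

(** The fifteen terms are the pairs of disjoint edges of K_5: this is the parity of a straight-line
    drawing, to which polygonal drawings are compared. *)
Lemma crosses_K5 a b c d e : uniq [:: a; b; c; d; e] ->
  crosses a b c d (+) crosses a b c e (+) crosses a b d e
  (+) crosses a c b d (+) crosses a c b e (+) crosses a c d e
  (+) crosses a d b c (+) crosses a d b e (+) crosses a d c e
  (+) crosses a e b c (+) crosses a e b d (+) crosses a e c d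
  (+) crosses b c d e (+) crosses b d c e (+) crosses b e c d.
Proof.
move=> u; rewrite /crosses.
distinct5 a b c d e u.
Qed.

Lemma crossesC a b c d : crosses a b c d = crosses c d a b.
Proof. by rewrite /crosses andbC. Qed.

(* The parity of the number of triangles of the fan from [p 0] that contain [c],
   i.e. the winding number mod 2 around [c] of the closed polygon p 0, ..., p n. *)
Definition winding (p : nat -> I) n c :=
  \big[addb/false]_(1 <= i < n) in_triangle (p 0) (p i) (p i.+1) c.

(** Induction along the polyline: [crosses_triangle] on the next fan triangle trades the chord to
    [p n.+1] and one more segment for the chord to [p n.+2]. *)
Lemma crosses_polyline_segment (p : nat -> I) n c d :
    {in [pred i | i <= n.+1] &, injective p} -> c != d ->
    (forall i, i <= n.+1 -> p i != c) -> (forall i, i <= n.+1 -> p i != d) ->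
  \big[addb/false]_(0 <= i < n.+1) crosses (p i) (p i.+1) c d =
  crosses (p 0) (p n.+1) c d (+) winding p n.+1 c (+) winding p n.+1 d.
Proof.
elim: n => [|n IHn] inj_p cd pc pd.
  by rewrite big_nat1 /winding !big_geq // !addbF.
rewrite big_nat_recr //= IHn //; last 3 first.
- by move=> i j /= /leqW ? /leqW ?; apply: inj_p.
- by move=> i /leqW; apply: pc.
- by move=> i /leqW; apply: pd.
rewrite /winding [in RHS]big_nat_recr // [X in _ = _ (+) X]big_nat_recr //=.
have u : uniq [:: p 0; p n.+1; p n.+2; c; d].
  rewrite /= !inE !negb_or cd !pc ?pd //= !andbT.
  by rewrite !(inj_in_eq inj_p) ?inE //= neq_ltn ltnSn.
have := crosses_triangle u.
move: (crosses _ _ c d) (crosses _ _ c d) (crosses _ _ c d) => x y z.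
move: (in_triangle _ _ _ c) (in_triangle _ _ _ d) => s t.
move: (\big[_/_]_(_ <= _ < _) _) (\big[_/_]_(_ <= _ < _) _) => X Y.
by move: X Y x y z s t => [] [] [] [] [] [] [].
Qed.

(** First [p] is replaced by its chord against each segment of [r], then [r] by its chord; the
    winding terms of the first round telescope to the ends of [r]. *)
Lemma crosses_polylines (p r : nat -> I) n m :
    {in [pred i | i <= n.+1] &, injective p} ->
    {in [pred i | i <= m.+1] &, injective r} ->
    (forall i j, i <= n.+1 -> j <= m.+1 -> p i != r j) ->
  \big[addb/false]_(0 <= i < n.+1) \big[addb/false]_(0 <= j < m.+1)
     crosses (p i) (p i.+1) (r j) (r j.+1) =
  crosses (p 0) (p n.+1) (r 0) (r m.+1)
  (+) (winding p n.+1 (r 0) (+) winding p n.+1 (r m.+1))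
  (+) (winding r m.+1 (p 0) (+) winding r m.+1 (p n.+1)).
Proof.
move=> inj_p inj_r pr; rewrite exchange_big_nat /=.
have E j : 0 <= j < m.+1 ->
    \big[addb/false]_(0 <= i < n.+1) crosses (p i) (p i.+1) (r j) (r j.+1) =
    crosses (p 0) (p n.+1) (r j) (r j.+1) (+)
    (winding p n.+1 (r j) (+) winding p n.+1 (r j.+1)).
  move=> /andP[_ jm]; rewrite addbA; apply: (crosses_polyline_segment inj_p).
  - by rewrite (inj_in_eq inj_r) ?inE ?(ltnW jm) // neq_ltn ltnSn.
  - by move=> i iN; apply: pr => //; exact: ltnW.
  - by move=> i iN; apply: pr.
rewrite (eq_big_nat _ _ E) big_split /= (eq_bigr _ (fun j _ => crossesC _ _ _ _)).
rewrite (crosses_polyline_segment inj_r); last 3 first.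
- by rewrite (inj_in_eq inj_p) ?inE.
- by move=> i iN; rewrite eq_sym; apply: pr.
- by move=> i iN; rewrite eq_sym; apply: pr.
have -> k : \big[addb/false]_(0 <= j < k)
    (winding p n.+1 (r j) (+) winding p n.+1 (r j.+1)) =
    winding p n.+1 (r 0) (+) winding p n.+1 (r k).
  elim: k => [|k IHk]; first by rewrite big_geq // addbb.
  by rewrite big_nat_recr // IHk /= -addbA addKb.
by rewrite crossesC -!addbA; congr (_ (+) _); rewrite addbA addbC -addbA.
Qed.

End Chirotope.

From Stdlib Require Import Ring.

(** Bending straight edges into polylines changes the crossing parity of a disjoint pair only by
    winding terms. These cancel over the fifteen pairs, so the total stays odd. *)
Lemma K5_polylines_cross (I : eqType) (o : I -> I -> I -> bool) (n : nat)
    (v : 'I_5 -> I) (p : 'I_5 -> 'I_5 -> nat -> I) :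
    chirotope o -> injective v ->
    (forall x y, p x y 0 = v x) -> (forall x y, p x y n.+1 = v y) ->
    (forall x y, x != y -> {in [pred i | i <= n.+1] &, injective (p x y)}) ->
    (forall x y z t i j, uniq [:: x; y; z; t] -> i <= n.+1 -> j <= n.+1 ->
       p x y i != p z t j) ->
  ~ (forall x y z t i j, uniq [:: x; y; z; t] -> i <= n -> j <= n ->
       ~~ crosses o (p x y i) (p x y i.+1) (p z t j) (p z t j.+1)).
Proof.
move=> oP inj_v p0 pn inj_p disj_p Ncross.
pose w x y z := winding o (p x y) n.+1 (v z).
(* Without crossings of polylines the double sum of [crosses_polylines] vanishes, which leaves the
   crossing of the chords equal to the winding terms. *)
have E x y z t : uniq [:: x; y; z; t] -> crosses o (v x) (v y) (v z) (v t) =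
    (w x y z (+) w x y t) (+) (w z t x (+) w z t y).
  move=> u; have [xy zt] : x != y /\ z != t.
    by move: u; rewrite /= !inE !negb_or => /and4P[/and3P[-> _ _] _ ->].
  have := crosses_polylines oP (inj_p x y xy) (inj_p z t zt)
    (fun i j => disj_p x y z t i j u).
  rewrite big1_seq => [|i]; last first.
    rewrite mem_index_iota => /andP[_ /andP[_ iN]].
    rewrite big1_seq // => j; rewrite mem_index_iota => /andP[_ /andP[_ jN]].
    exact/negbTE/Ncross.
  rewrite !p0 !pn /w.
  move: (crosses _ _ _ _ _) (winding _ _ _ _) (winding _ _ _ _).
  move: (winding _ _ _ _) (winding _ _ _ _).
  by do 5 case.
pose i0 : 'I_5 := @Ordinal 5 0 isT; pose i1 : 'I_5 := @Ordinal 5 1 isT.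
pose i2 : 'I_5 := @Ordinal 5 2 isT; pose i3 : 'I_5 := @Ordinal 5 3 isT.
pose i4 : 'I_5 := @Ordinal 5 4 isT.
have := @crosses_K5 _ _ oP (v i0) (v i1) (v i2) (v i3) (v i4).
rewrite (map_inj_uniq inj_v [:: i0; i1; i2; i3; i4]) => /(_ isT).
(* Each [w x y z] occurs twice: for the two edges at [z] disjoint from [xy]. *)
have addbE a b : addb a b = xorb a b by case: a.
rewrite !E //; apply/negP/negbT; rewrite !addbE; ring.
Qed.

(** * Graph invariants *)

Section BigMin.
Variables (I : finType) (P : pred I) (G : I -> nat).

(** The default [d] takes part in the minimum, hence the condition [m <= d]. *)
Lemma bigmin_eq d i m : P i -> G i = m -> m <= d ->
  (forall j, P j -> m <= G j) -> \big[minn/d]_(j | P j) G j = m.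
Proof.
move=> Pi Gi md mG; apply/eqP; rewrite eqn_leq; apply/andP; split; last first.
  by apply: (big_ind (fun x => m <= x)) => // x y mx my; rewrite leq_min mx.
rewrite -Gi; elim: (index_enum I) (mem_index_enum i) => // j r IHr.
rewrite inE big_cons => /predU1P[<-|/IHr le_i]; first by rewrite Pi geq_minl.
by case: ifP => _ //; apply: leq_trans (geq_minr _ _) le_i.
Qed.

End BigMin.

Section Distance.
Variables (T : finType) (e : rel T).
(** Distances are searched below [#|T|] and cycle lengths up to [#|T|]; three vertices put the
    values 2 and 3 within range. *)
Hypothesis T3 : 2 < #|T|.

Lemma has_walkP x y k :
  reflect (exists p : seq T, [/\ size p = k, path e x p & last x p = y])
          (has_walk e x y k).
Proof.
apply: (iffP existsP) => [[p /andP[ep /eqP]]|[p [sp ep lp]]].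
  by exists p; rewrite size_tuple.
by move/eqP: sp => sp; exists (Tuple sp); rewrite ep /= lp eqxx.
Qed.

Lemma has_walk0 x y : has_walk e x y 0 = (x == y).
Proof.
by apply/has_walkP/eqP => [[p [/size0nil -> //]]|->]; exists [::].
Qed.

Lemma has_walk1 x y : has_walk e x y 1 = e x y.
Proof.
apply/has_walkP/idP => [[p []]|exy]; last by exists [:: y]; rewrite /= exy.
by case: p => [|z [|]] //= _; rewrite andbT => ? <-.
Qed.

Lemma has_walk2 x y z : e x y -> e y z -> has_walk e x z 2.
Proof. by move=> xy yz; apply/has_walkP; exists [:: y; z]; rewrite /= xy yz. Qed.

Lemma graph_dist_eq0 x : graph_dist e x x = 0.
Proof. by rewrite /graph_dist; case: #|T| T3 => // n _; rewrite /= has_walk0 eqxx. Qed.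

Lemma graph_dist_eq1 x y : x != y -> e x y -> graph_dist e x y = 1.
Proof.
move=> xy exy; rewrite /graph_dist; case: #|T| T3 => [|[|n]] // _.
by rewrite /= has_walk0 (negPf xy) has_walk1 exy.
Qed.

Lemma graph_dist_eq2 x y z : x != z -> ~~ e x z -> e x y -> e y z ->
  graph_dist e x z = 2.
Proof.
move=> xz Nexz xy yz; rewrite /graph_dist; case: #|T| T3 => [|[|[|n]]] // _.
by rewrite /= has_walk0 (negPf xz) has_walk1 (negPf Nexz) (has_walk2 xy yz).
Qed.

Lemma graph_girth_triangle x : irreflexive e -> on_triangle e x -> graph_girth e = 3.
Proof.
move=> irr [y [z [xy yz zx]]]; rewrite /graph_girth.
have c3 : has_cycle e 3.
  apply/andP; split=> //; apply/existsP; exists [tuple x; y; z].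
  rewrite /ucycleb /= xy yz zx /= !inE negb_or andbT.
  by apply/andP; split; [apply/andP; split|]; apply: contraTneq isT => E;
    move: xy yz zx; rewrite ?E irr.
by case: #|T| T3 => [|[|[|n]]] // _; rewrite /= c3.
Qed.

End Distance.

Lemma clique_embedding (T : finType) (e : rel T) n (S : {set T}) :
    clique e S -> n <= #|S| ->
  exists2 f : 'I_n -> T, injective f & forall i j, i != j -> e (f i) (f j).
Proof.
move=> /forall_inP cS nS; exists (fun i => enum_val (widen_ord nS i)).
  by move=> i j /enum_val_inj/(congr1 val) /= /val_inj.
move=> i j ij; have enumS k := enum_valP (widen_ord nS k).
have /forall_inP/(_ _ (enumS j))/implyP := cS _ (enumS i).
by apply; rewrite (inj_eq enum_val_inj) -val_eqE.
Qed.

(* [inc A k] says that the vertex [A] is contained in the block [k]; in the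
   application the blocks are the Borel subalgebras. *)
Section BlockGraph.
Variables (T K : finType) (e : rel T) (inc : T -> K -> bool) (pt blk : K -> T).
Hypothesis eE : forall A B,
  e A B = (A != B) && [forall k, ~~ (inc A k && inc B k)].
(** In the application [pt k] is a nilpotent line and [blk k] the Borel subalgebra itself: two
    distinct vertices of one block, so that each vertex of a block has a non-neighbour. *)
Hypothesis inc_pt : forall k k', inc (pt k) k' = (k == k').
Hypothesis inc_blk : forall k, inc (blk k) k.
Hypothesis blk_pt : forall k, blk k != pt k.

Definition free_vertices := [set A | [forall k, ~~ inc A k]].

Hypothesis free2 : 1 < #|free_vertices|.
Hypothesis K2 : 1 < #|K|.

Lemma block_graph_sym : symmetric e.
Proof. by move=> A B; rewrite !eE eq_sym; under eq_forallb do rewrite andbC. Qed.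

Lemma block_graph_irr : irreflexive e.
Proof. by move=> A; rewrite eE eqxx. Qed.

Lemma free_adj A B : A \in free_vertices -> A != B -> e A B.
Proof.
rewrite inE eE => /forallP fA -> /=; apply/forallP => k.
by rewrite negb_and fA.
Qed.

Lemma pt_adj k k' : k != k' -> e (pt k) (pt k').
Proof.
move=> kk'; rewrite eE; apply/andP; split.
  by apply: contraNneq kk' => E; rewrite -(inc_pt k k') E inc_pt.
apply/forallP => k''; rewrite !inc_pt negb_and.
by case: eqP => //= <-; rewrite eq_sym.
Qed.

Lemma not_free_nonadj A : A \notin free_vertices ->
  exists2 B, A != B & ~~ e A B.
Proof.
rewrite inE => /forallPn[k]; rewrite negbK => Ak.
have [E|nE] := eqVneq A (blk k).
  exists (pt k); first by rewrite E blk_pt.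
  by rewrite eE negb_and; apply/orP; right; apply/forallPn; exists k;
    rewrite Ak inc_pt eqxx.
exists (blk k) => //.
by rewrite eE negb_and; apply/orP; right; apply/forallPn; exists k;
  rewrite Ak inc_blk.
Qed.

Lemma two_free : exists A B, [/\ A \in free_vertices, B \in free_vertices & A != B].
Proof. by case/card_gt1P: free2 => A [B [? ? ?]]; exists A, B. Qed.

Lemma two_blocks : exists k k' : K, k != k'.
Proof. by case/card_gt1P: K2 => k [k' [_ _ ?]]; exists k, k'. Qed.

Lemma pt_not_free k : pt k \notin free_vertices.
Proof. by rewrite inE; apply/forallPn; exists k; rewrite inc_pt eqxx. Qed.

Lemma block_graph_card : 2 < #|T|.
Proof.
have [A [B [fA fB AB]]] := two_free; have [k _] := two_blocks.
have u : uniq [:: A; B; pt k].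
  rewrite /= !inE negb_or AB /= andbT; apply/andP; split;
  by apply: contraNneq (pt_not_free k) => <-.
by rewrite -[3]/(size [:: A; B; pt k]) -(card_uniqP u) max_card.
Qed.

(** A free vertex is completed by the points of two blocks, any other vertex by two free ones. *)
Lemma block_graph_triangle A : on_triangle e A.
Proof.
have [fA|nfA] := boolP (A \in free_vertices).
  have [k [k' kk']] := two_blocks; exists (pt k), (pt k').
  have Apt l : A != pt l by apply: contraNneq (pt_not_free l) => <-.
  by split; rewrite ?pt_adj ?(free_adj fA) // block_graph_sym free_adj.
have [B [C [fB fC BC]]] := two_free; exists B, C.
have nA D : D \in free_vertices -> D != A by apply: contraTneq => ->.
split; [rewrite block_graph_sym | exact: free_adj |]; by rewrite free_adj ?nA.
Qed.

Lemma block_graph_girth : graph_girth e = 3.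
Proof.
have [k _] := two_blocks.
apply: (graph_girth_triangle block_graph_card block_graph_irr).
exact: (block_graph_triangle (pt k)).
Qed.

(** A free vertex is adjacent to all others, so it is a midpoint for every nonadjacent pair. *)
Lemma block_graph_dist_le2 A B : graph_dist e A B <= 2.
Proof.
have T3 := block_graph_card.
have [->|AB] := eqVneq A B; first by rewrite graph_dist_eq0.
have [eAB|nAB] := boolP (e A B); first by rewrite graph_dist_eq1.
have [C [_ [fC _ _]]] := two_free.
have CA : C != A by apply: contraNneq nAB => E; rewrite free_adj // -E.
have CB : C != B.
  by apply: contraNneq nAB => E; rewrite block_graph_sym free_adj // -?E // eq_sym E.
by rewrite (graph_dist_eq2 T3 AB nAB (y := C)) // ?[e A C]block_graph_sym free_adj.
Qed.

Lemma free_eccentricity A : A \in free_vertices -> graph_eccentricity e A = 1.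
Proof.
move=> fA; have T3 := block_graph_card; have [k _] := two_blocks.
have Apt : A != pt k by apply: contraNneq (pt_not_free k) => <-.
apply/eqP; rewrite eqn_leq; apply/andP; split.
  apply/bigmax_leqP => B _; have [->|AB] := eqVneq A B.
    by rewrite graph_dist_eq0.
  by rewrite graph_dist_eq1 ?free_adj.
by apply: leq_trans (leq_bigmax (pt k)); rewrite graph_dist_eq1 ?free_adj.
Qed.

Lemma not_free_eccentricity A : A \notin free_vertices -> graph_eccentricity e A = 2.
Proof.
move=> nfA; have T3 := block_graph_card.
apply/eqP; rewrite eqn_leq; apply/andP; split.
  by apply/bigmax_leqP => B _; exact: block_graph_dist_le2.
have [B AB nAB] := not_free_nonadj nfA.
apply: leq_trans (leq_bigmax B).
have [C [_ [fC _ _]]] := two_free.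
have CA : C != A by apply: contraNneq nfA => <-.
have CB : C != B.
  by apply: contraNneq nAB => E; rewrite block_graph_sym free_adj // -?E // eq_sym E.
by rewrite (graph_dist_eq2 T3 AB nAB (y := C)) // ?[e A C]block_graph_sym free_adj.
Qed.

Lemma block_graph_connected : graph_connected e.
Proof.
move=> A B; have [<-|AB] := eqVneq A B; first exact: connect0.
have [eAB|nAB] := boolP (e A B); first exact: connect1.
have [C [_ [fC _ _]]] := two_free.
have CA : C != A by apply: contraNneq nAB => E; rewrite free_adj // -E.
have CB : C != B.
  by apply: contraNneq nAB => E; rewrite block_graph_sym free_adj // -?E // eq_sym E.
apply: (@connect_trans _ _ C); apply: connect1; last exact: free_adj.
by rewrite block_graph_sym free_adj.
Qed.

Lemma block_graph_diameter : graph_diameter e = 2.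
Proof.
have [k _] := two_blocks.
apply/eqP; rewrite eqn_leq; apply/andP; split; last first.
  by apply: leq_trans (leq_bigmax (pt k)); rewrite not_free_eccentricity ?pt_not_free.
apply/bigmax_leqP => A _; have [fA|nfA] := boolP (A \in free_vertices).
  by rewrite free_eccentricity.
by rewrite not_free_eccentricity.
Qed.

Lemma block_graph_radius : graph_radius e = 1.
Proof.
have [A [_ [fA _ _]]] := two_free.
apply: (bigmin_eq (i := A)) => //; first exact: free_eccentricity.
  by rewrite (ltn_trans _ block_graph_card).
move=> B _; have [fB|nfB] := boolP (B \in free_vertices).
  by rewrite free_eccentricity.
by rewrite not_free_eccentricity.
Qed.

Lemma block_graph_center : graph_center e = free_vertices.
Proof.
apply/setP => A; rewrite inE block_graph_radius.
have [fA|nfA] := boolP (A \in free_vertices); first by rewrite free_eccentricity.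
by rewrite not_free_eccentricity.
Qed.

Lemma block_graph_domination : domination_number e = 1.
Proof.
have [A [_ [fA _ _]]] := two_free.
apply: (bigmin_eq (i := [set A])).
- apply/forallP => B; apply/implyP; rewrite inE => BA.
  by apply/exists_inP; exists A; rewrite ?inE // block_graph_sym free_adj // eq_sym.
- exact: cards1.
- by rewrite (ltn_trans _ block_graph_card).
move=> S /forallP/(_ A)/implyP domS; rewrite card_gt0; apply/set0Pn.
have [AS|/domS/exists_inP[B BS _]] := boolP (A \in S); first by exists A.
by exists B.
Qed.

Lemma free_pts_clique : clique e (free_vertices :|: pt @: [set: K]).
Proof.
apply/forall_inP => A; rewrite inE => /orP[fA|/imsetP[k _ ->]].
  by apply/forall_inP => B _; apply/implyP; apply: free_adj.
apply/forall_inP => B; rewrite inE => /orP[fB|/imsetP[k' _ ->]]; apply/implyP.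
  by rewrite block_graph_sym eq_sym; apply: free_adj.
by move=> kk'; apply: pt_adj; apply: contraNneq kk' => ->.
Qed.

Lemma card_free_pts : #|free_vertices :|: pt @: [set: K]| = #|free_vertices| + #|K|.
Proof.
rewrite cardsU card_imset ?cardsT.
  suff -> : free_vertices :&: pt @: [set: K] = finset.set0 by rewrite cards0 subn0.
  apply/setP => A; rewrite finset.in_set0 finset.in_setI.
  apply/andP => -[fA /imsetP[k _ E]].
  by have := pt_not_free k; rewrite -E fA.
by move=> k k' E; apply/eqP; rewrite -inc_pt E inc_pt.
Qed.

(* A clique has at most one vertex in each block, so choosing a block for each of
   its vertices that are not free is injective. *)
Lemma block_graph_clique : clique_number e = #|free_vertices| + #|K|.
Proof.
apply/eqP; rewrite eqn_leq; apply/andP; split; last first.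
  by rewrite -card_free_pts; apply: leq_bigmax_cond; exact: free_pts_clique.
apply/bigmax_leqP => S /forall_inP cS.
rewrite -(cardsID free_vertices S); apply: leq_add.
  by rewrite subset_leq_card // subsetIr.
(* The default [k0] is taken only at free vertices, where [f] is not evaluated below. *)
have [k0 _] := two_blocks; pose f A := odflt k0 [pick k | inc A k].
have incf A : A \in S :\: free_vertices -> inc A (f A).
  rewrite inE => /andP[]; rewrite inE => /forallPn[k]; rewrite negbK => Ak _.
  by rewrite /f; case: pickP => [//|/(_ k)]; rewrite Ak.
rewrite -(card_in_imset (f := f)) ?max_card // => A B AS BS fAB.
have := incf A AS; have := incf B BS; move: AS BS; rewrite !inE.
move=> /andP[_ AS] /andP[_ BS]; rewrite -fAB => incB incA.
apply/eqP/negPn/negP => AB.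
have /forall_inP/(_ B BS)/implyP/(_ AB) := cS A AS.
by rewrite eE AB => /forallP/(_ (f A)); rewrite incA incB.
Qed.

End BlockGraph.

(** * Polygonal approximation and non-planarity *)

From mathcomp Require Import ring lra.
Import Order.TTheory GRing.Theory Num.Theory.
Import numFieldNormedType.Exports.

(** * Orientations, segments and general position in the plane *)

Section Plane.
Local Open Scope ring_scope.
Variable R : realFieldType.
Implicit Types a b c d : (R * R)%type.

(** Twice the signed area of the triangle, positive when it is counterclockwise. *)
Definition det3 a b c : R :=
  (b.1 - a.1) * (c.2 - a.2) - (b.2 - a.2) * (c.1 - a.1).

Lemma addb_gt0 (x y : R) : x != 0 -> y != 0 ->
  (0 < x) (+) (0 < y) = (x * y < 0).
Proof.
case: ltrgt0P => // x0 _; case: ltrgt0P => // y0 _ /=.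
- by rewrite ltNge ltW ?mulr_gt0.
- by rewrite pmulr_rlt0.
- by rewrite nmulr_rlt0.
- by rewrite ltNge ltW // nmulr_rgt0.
Qed.

(** The Grassmann-Pluecker relation is a polynomial identity here; if its two outer products have
    the same sign, the middle one, being their sum, has it too. *)
Lemma chirotope_det3 (I : eqType) (P : I -> R * R) :
    (forall i j k, uniq [:: i; j; k] -> det3 (P i) (P j) (P k) != 0) ->
  chirotope (fun i j k => 0 < det3 (P i) (P j) (P k)).
Proof.
move=> gen; split=> [i j k|i j k u|a b c d e u].
- by congr (0 < _); rewrite /det3; ring.
- have -> : det3 (P i) (P k) (P j) = - det3 (P i) (P j) (P k).
    by rewrite /det3; ring.
  by rewrite oppr_gt0 -leNgt le_eqVlt (negPf (gen _ _ _ u)).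
have GP : det3 (P a) (P b) (P c) * det3 (P a) (P d) (P e)
        - det3 (P a) (P b) (P d) * det3 (P a) (P c) (P e)
        + det3 (P a) (P b) (P e) * det3 (P a) (P c) (P d) = 0.
  by rewrite /det3; ring.
have N i j k : i != j -> i != k -> j != k -> det3 (P i) (P j) (P k) != 0.
  by move=> ij ik jk; apply: gen; rewrite /= !inE negb_or ij ik jk.
move: u; rewrite /= !inE !negb_or => /and5P[/and4P[? ? ? ?] /and3P[? ? ?]].
move=> /andP[? ?] ? _; rewrite !addb_gt0 ?N //.
move: (_ * det3 (P a) (P d) _) (_ * det3 (P a) (P c) (P e)) GP.
move: (_ * det3 (P a) (P c) (P d)).
by move=> z x y; case: (ltP x 0); case: (ltP y 0); case: (ltP z 0) => //=; lra.
Qed.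

Definition affine a b (s : R) : R * R :=
  (a.1 + s * (b.1 - a.1), a.2 + s * (b.2 - a.2)).

Lemma ratio_itv (x y : R) : x * y < 0 -> 0 <= x / (x - y) <= 1.
Proof.
have [x0 xy|x0 xy|->] := ltrgt0P x; last by rewrite mul0r ltxx.
- have y0 : y < 0 by rewrite -(pmulr_rlt0 _ x0).
  by rewrite divr_ge0 ?ler_pdivrMr; lra.
- have y0 : 0 < y by rewrite -(nmulr_rlt0 _ x0).
  by rewrite -mulrNN -invrN divr_ge0 ?ler_pdivrMr; lra.
Qed.

Lemma segments_meet a b c d :
    det3 a b c * det3 a b d < 0 -> det3 c d a * det3 c d b < 0 ->
  exists s t, [/\ 0 <= s <= 1, 0 <= t <= 1 & affine a b s = affine c d t].
Proof.
move=> abcd cdab.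
(* An affine function with values [x] and [y] at 0 and 1 vanishes at [x / (x - y)]. This is applied
   to [det3 c d] along [ab] and to [det3 a b] along [cd]. *)
exists (det3 c d a / (det3 c d a - det3 c d b)).
exists (det3 a b c / (det3 a b c - det3 a b d)).
split; [exact: ratio_itv..|].
have N x y : x * y < 0 -> x - y != 0 :> R.
  by rewrite subr_eq0; apply: contraTneq => ->; rewrite -leNgt -expr2 sqr_ge0.
have := N _ _ abcd; have := N _ _ cdab.
case: a b c d abcd cdab => [a1 a2] [b1 b2] [c1 c2] [d1 d2] _ _.
rewrite /affine /det3 /= => N1 N2.
by congr (_, _); field; rewrite ?N1 ?N2.
Qed.

(** Balls are convex; the norm being the maximum norm, this is checked on each coordinate. *)
Lemma affine_near a b A (s e : R) : 0 <= s <= 1 ->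
    `|A - a| < e -> `|A - b| < e -> `|A - affine a b s| < e.
Proof.
move=> /andP[s0 s1].
have C x y : `|x| < e -> `|y| < e -> `|x + s * (y - x)| < e.
  move=> xe ye; have -> : x + s * (y - x) = (1 - s) * x + s * y by ring.
  apply: le_lt_trans (ler_normD _ _) _; rewrite !normrM (ger0_norm s0).
  rewrite ger0_norm ?subr_ge0 //; move: s1; rewrite le_eqVlt => /predU1P[->|s1].
    by rewrite subrr mul0r add0r mul1r.
  have : 0 < (1 - s) * (e - `|x|) by rewrite mulr_gt0 ?subr_gt0.
  have : 0 <= s * (e - `|y|) by rewrite mulr_ge0 ?subr_ge0 // ltW.
  by lra.
rewrite !prod_normE !gt_max /= => /andP[Aa1 Aa2] /andP[Ab1 Ab2].
have := C _ _ Aa1 Ab1; have := C _ _ Aa2 Ab2.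
have E (x y z : R) : z - x + s * (z - y - (z - x)) = z - (x + s * (y - x)) by ring.
by rewrite !E => -> ->.
Qed.

Lemma exists_small_nonroot (p : {poly R}) (e : R) : p != 0 -> 0 < e ->
  exists2 d, 0 < d < e & p.[d] != 0.
Proof.
(* There are [size p] candidates, more than [p] has roots; the offset 2 in the denominator keeps all
   of them strictly below [e]. *)
move=> p0 e0; pose s := [seq e / n.+2%:R | n <- iota 0 (size p)].
have us : uniq s.
  rewrite map_inj_uniq ?iota_uniq // => m n /(mulfI (lt0r_neq0 e0)) /invr_inj.
  by move=> /eqP; rewrite eqr_nat => /eqP [].
have /allPn[d /mapP[n _ ->] pd] : ~~ all (root p) s.
  apply/negP => /(max_poly_roots p0) /(_ us).
  by rewrite size_map size_iota ltnn.
exists (e / n.+2%:R) => //.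
by rewrite divr_gt0 ?ltr0n //= ltr_pdivrMr ?ltr0n // ltr_pMr // ltr1n.
Qed.

(* Move point number [k] by [d (k, k^2)]: each determinant becomes a polynomial in
   [d] whose leading coefficient is a Vandermonde determinant. *)
Lemma generic_perturbation (I : finType) (P : I -> R * R) (e : R) : 0 < e ->
  exists2 Q : I -> R * R,
    forall i, `|P i - Q i| < e &
    forall i j k, uniq [:: i; j; k] -> det3 (Q i) (Q j) (Q k) != 0.
Proof.
move=> e0; pose w (i : I) : R := (enum_rank i)%:R.
have w_inj : injective w.
  by move=> i j /eqP; rewrite eqr_nat => /eqP/ord_inj/enum_rank_inj.
pose D i j k : {poly R} :=
  (((P j).1 - (P i).1)%:P + (w j - w i)%:P * 'X) *
  (((P k).2 - (P i).2)%:P + (w k ^+ 2 - w i ^+ 2)%:P * 'X) -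
  (((P j).2 - (P i).2)%:P + (w j ^+ 2 - w i ^+ 2)%:P * 'X) *
  (((P k).1 - (P i).1)%:P + (w k - w i)%:P * 'X).
have D_neq0 i j k : uniq [:: i; j; k] -> D i j k != 0.
  rewrite /= !inE negb_or => /and3P[/andP[ij ik] jk _].
  apply: contra_neq (_ : (w j - w i) * (w k - w i) * (w k - w j) != 0) => [D0|].
    have := congr1 (fun p : {poly R} => p`_2) D0; rewrite coef0.
    have -> : D i j k =
        ((w j - w i) * (w k - w i) * (w k - w j))%:P * 'X^2 +
        (((P j).1 - (P i).1) * (w k ^+ 2 - w i ^+ 2) +
         (w j - w i) * ((P k).2 - (P i).2) -
         ((P j).2 - (P i).2) * (w k - w i) -
         (w j ^+ 2 - w i ^+ 2) * ((P k).1 - (P i).1))%:P * 'X +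
        (det3 (P i) (P j) (P k))%:P by rewrite /D /det3; ring.
    by rewrite !coefD !coefCM coefXn coefX coefC mulr1 mulr0 !addr0.
  by rewrite !mulf_neq0 // subr_eq0 (inj_eq w_inj) eq_sym.
(* A nonroot of the product serves all triples at once. *)
pose p := \prod_(x : I * I * I | uniq [:: x.1.1; x.1.2; x.2]) D x.1.1 x.1.2 x.2.
have p0 : p != 0 by apply/prodf_neq0 => x; exact: D_neq0.
(* Coordinates move by at most [d * #|I| ^ 2], so dividing [e] by this constant keeps the
   displacement below [e]. *)
have M0 : 0 < (#|I| ^ 2).+1%:R :> R by rewrite ltr0n.
have [d /andP[d0 dM] pd] := exists_small_nonroot p0 (divr_gt0 e0 M0).
exists (fun i => ((P i).1 + d * w i, (P i).2 + d * w i ^+ 2)) => [i|i j k u].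
  have small m : (m <= #|I| ^ 2)%N -> `|d * m%:R| < e.
    move=> mI; rewrite ger0_norm ?mulr_ge0 ?ler0n ?ltW //.
    move: dM; rewrite ltr_pdivlMr //; apply: le_lt_trans.
    by apply: ler_wpM2l; [exact: ltW | rewrite ler_nat leqW].
  have wI := ltnW (ltn_ord (enum_rank i)).
  have sub_add (x y : R) : x - (x + y) = - y by ring.
  rewrite prod_normE gt_max /= !sub_add !normrN -natrX !small // ?leq_sqr //.
  by apply: leq_trans wI _; case: #|I| => // n; rewrite leq_pmulr.
apply: contraNneq pd => D0; rewrite /p horner_prod.
apply/prodf_eq0; exists (i, j, k) => //=.
rewrite -[X in _ == X]D0 /D /det3 /= !(hornerD, hornerN, hornerM, hornerC, hornerX).
by apply/eqP; ring.
Qed.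
End Plane.

(** * Compactness estimates for continuous arcs *)

Section Arcs.
Local Open Scope ring_scope.
Local Open Scope classical_set_scope.
Variable R : realType.
Implicit Types f g : R -> (R * R)%type.

Lemma within_continuous_dist f (x e : R) :
    {within `[0, 1], continuous f} -> x \in `[0, 1]%R -> 0 < e ->
  exists2 r, 0 < r &
    forall y, y \in `[0, 1]%R -> `|x - y| < r -> `|f x - f y| < e.
Proof.
move=> /subspace_continuousP cf x01 e0.
have /cvgrPdist_lt /(_ e e0) := cf x x01.
move=> [r /= r0 xr]; exists r => // y y01 xy; exact: xr.
Qed.

(** Heine's theorem through near coverings of the compact interval. As an eventual statement in [d]
    it can be intersected over finitely many arcs. *)
Lemma within_continuous_unif f (e : R) :
    {within `[0, 1], continuous f} -> 0 < e ->
  \forall d \near 0^'+, forall s t : R, s \in `[0, 1]%R -> t \in `[0, 1]%R ->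
    `|s - t| < d -> `|f s - f t| < e.
Proof.
move=> cf e0.
have /compact_near_coveringP/near_covering_withinP K := @segment_compact R 0 1.
have := @K R 0^'+ (fun d s => forall t : R, t \in `[0, 1]%R ->
                        `|s - t| < d -> `|f s - f t| < e).
suff H : forall x : R, `[0, 1] x ->
     \forall x' \near x & d \near 0^'+,
     `[0, 1] x' -> forall t, t \in `[0, 1]%R -> `|x' - t| < d -> `|f x' - f t| < e.
  by move/(_ (at_right_proper_filter 0) H); apply: filterS => d Hd s t s01; exact: Hd.
move=> x x01; have e20 : 0 < e / 2 by rewrite divr_gt0.
have [r r0 xr] := within_continuous_dist cf x01 e20.
near=> s d => /= s01 t t01 st.
have xs : `|x - s| < r / 2 :> R by near: s; apply: nbhsx_ballx; rewrite divr_gt0.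
have dr : d < r / 2 by near: d; apply: nbhs_right_lt; rewrite divr_gt0.
have /(xr _ s01) : `|x - s| < r by lra.
have /(xr _ t01) : `|x - t| < r.
  rewrite -(subrKA s) [r]splitr; apply: le_lt_trans (ler_normD _ _) _.
  by apply: ltrD => //; apply: lt_trans dr.
have := ler_normD (f s - f x) (f x - f t); rewrite subrKA (distrC (f s) (f x)).
move: `|f s - f t| `|f x - f s| `|f x - f t| => X Y Z; lra.
Unshelve. all: by end_near. Qed.

Lemma dist_arc_gt0 g (c : R * R) :
    {within `[0, 1], continuous g} -> (forall t : R, t \in `[0, 1]%R -> c <> g t) ->
  \forall d \near 0^'+, forall t : R, t \in `[0, 1]%R -> d <= `|c - g t|.
Proof.
move=> cg cNg.
have /compact_near_coveringP/near_covering_withinP K := @segment_compact R 0 1.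
apply: (@K R 0^'+ (fun d t => d <= `|c - g t|) _) => t t01.
have e0 : 0 < `|c - g t| / 2.
  by rewrite divr_gt0 // normr_gt0 subr_eq0; apply/eqP/cNg.
have [r r0 tr] := within_continuous_dist cg t01 e0.
near=> t' d => /= t'01.
have dr : d < `|c - g t| / 2 by near: d; apply: nbhs_right_lt.
have /(tr _ t'01) : `|t - t'| < r by near: t'; apply: nbhsx_ballx.
have := ler_normD (c - g t') (g t' - g t); rewrite subrKA (distrC (g t') (g t)).
move: `|c - g t| `|c - g t'| `|g t - g t'| dr => x y z; lra.
Unshelve. all: by end_near. Qed.

(** Compactness is used twice: [dist_arc_gt0] gives a bound [e] at each point of [f], half of which
    survives nearby, and finitely many neighbourhoods cover [f]. *)
Lemma dist_arcs_gt0 f g :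
    {within `[0, 1], continuous f} -> {within `[0, 1], continuous g} ->
    (forall s t : R, s \in `[0, 1]%R -> t \in `[0, 1]%R -> f s <> g t) ->
  \forall d \near 0^'+, forall s t : R, s \in `[0, 1]%R -> t \in `[0, 1]%R ->
    d <= `|f s - g t|.
Proof.
move=> cf cg fNg.
have /compact_near_coveringP/near_covering_withinP K := @segment_compact R 0 1.
have := @K R 0^'+ (fun d s => forall t : R, t \in `[0, 1]%R -> d <= `|f s - g t|).
suff H : forall x : R, `[0, 1] x ->
     \forall x' \near x & d \near 0^'+,
     `[0, 1] x' -> forall t, t \in `[0, 1]%R -> d <= `|f x' - g t|.
  by move/(_ (at_right_proper_filter 0) H); apply: filterS => d Hd s t s01; exact: Hd.
move=> x x01.
near (0:R)^'+ => e.
have e0 : 0 < e by [].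
have He : forall t, t \in `[0, 1]%R -> e <= `|f x - g t|.
  near: e; apply: dist_arc_gt0 => // t; exact: fNg.
have e20 : 0 < e / 2 by rewrite divr_gt0.
have [r r0 xr] := within_continuous_dist cf x01 e20.
near=> s d => /= s01 t t01.
have dr : d < e / 2 by near: d; apply: nbhs_right_lt; rewrite divr_gt0.
have /(xr _ s01) : `|x - s| < r by near: s; apply: nbhsx_ballx.
have := ler_normD (f x - f s) (f s - g t); rewrite subrKA.
have := He t t01.
move: `|f x - g t| `|f s - g t| `|f x - f s| dr => X Y Z; lra.
Unshelve. all: by end_near. Qed.

End Arcs.

(** * From planar drawings to polygonal ones *)

Section Drawing.
Local Open Scope ring_scope.
Variables (R : realType) (T : finType) (e : rel T).
Variables (pt : T -> R * R) (arc : T -> T -> R -> R * R).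
Hypothesis drawn : planar_drawing e pt arc.

(** Each parameter is an end or interior. Two ends differ by injectivity of [pt], an end and an
    interior point because edges avoid vertices, two interior points because distinct edges do not
    meet. *)
Lemma disjoint_arcs x y z t (r s : R) :
    e x y -> e z t -> uniq [:: x; y; z; t] ->
    r \in `[0, 1] -> s \in `[0, 1] -> arc x y r <> arc z t s.
Proof.
case: drawn => inj_pt arcP noV noE xy zt.
rewrite /= !inE !negb_or => /and4P[/and3P[nxy nxz nxt] /andP[nyz nyt] nzt _].
have [_ _ xy0 xy1 _] := arcP _ _ xy; have [_ _ zt0 zt1 _] := arcP _ _ zt.
have ends (u : R) : u \in `[0, 1] -> [\/ u = 0, u = 1 | u \in `]0, 1[].
  rewrite !in_itv /= => /andP[].
  rewrite le_eqVlt => /predU1P[<-|u0]; first by constructor 1.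
  rewrite le_eqVlt => /predU1P[->|u1]; first by constructor 2.
  by constructor 3; rewrite u0.
have ptN a b : a != b -> pt a <> pt b by move=> /eqP ab /inj_pt.
move=> /ends r01 /ends s01.
have nset : [set x; y]%SET != [set z; t]%SET.
  apply/eqP => /setP/(_ x).
  by rewrite !inE eqxx (negPf nxz) (negPf nxt).
case: r01 => [->|->|r01]; case: s01 => [->|->|s01];
  rewrite ?xy0 ?xy1 ?zt0 ?zt1; try exact: ptN.
- by move/esym; apply: noV.
- by move/esym; apply: noV.
- exact: noV.
- exact: noV.
- exact: noE.
Qed.

End Drawing.

Section K5Drawing.
Local Open Scope ring_scope.

Lemma K5_not_planar (R : realType) (T : finType) (e : rel T) (f : 'I_5 -> T) :
  injective f -> (forall x y, x != y -> e (f x) (f y)) -> ~ planar e R.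
Proof.
move=> inj_f ef [pt [arc0 drawn]]; case: (drawn) => inj_pt arcP _ _.
pose arc x y := arc0 (f x) (f y).
have cont x y : x != y -> {within `[0, 1], continuous (arc x y)}%classic.
  by move=> /ef /arcP[].
near ((0 : R)^'+)%classic => d.
have d0 : 0 < d by [].
have d20 : 0 < d / 2 by rewrite divr_gt0.
have sep x y z t : uniq [:: x; y; z; t] -> forall r s : R,
    r \in `[0, 1] -> s \in `[0, 1] -> d <= `|arc x y r - arc z t s|.
  move: x y z t.
  (* The quadruple is packed into one finite type, so that [filter_forall] yields a single [d]. *)
  suff H : forall q : 'I_5 * 'I_5 * 'I_5 * 'I_5,
      uniq [:: q.1.1.1; q.1.1.2; q.1.2; q.2] ->
      forall r s : R, r \in `[0, 1] -> s \in `[0, 1] ->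
      d <= `|arc q.1.1.1 q.1.1.2 r - arc q.1.2 q.2 s|.
    by move=> x y z t; apply: (H (x, y, z, t)).
  near: d; apply: filter_forall => -[[[x y] z] t] /=.
  case: (boolP (uniq [:: x; y; z; t])) => [u|nu]; last first.
    by apply: nearW => k u; case/negP: nu.
  have [xy zt] : x != y /\ z != t.
    by move: u; rewrite /= !inE !negb_or => /and4P[/and3P[-> _ _] _ ->].
  have ND r s : r \in `[0, 1] -> s \in `[0, 1] -> arc x y r <> arc z t s.
    apply: (disjoint_arcs drawn); [exact: ef..|].
    by rewrite (map_inj_uniq inj_f [:: x; y; z; t]).
  have := dist_arcs_gt0 (cont x y xy) (cont z t zt) ND.
  by apply: filterS => k H _; exact: H.
near ((0 : R)^'+)%classic => h.
have h0 : 0 < h by [].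
have unif x y : x != y -> forall r s : R, r \in `[0, 1] -> s \in `[0, 1] ->
    `|r - s| < h -> `|arc x y r - arc x y s| < d / 2 / 2.
  move: x y.
  suff H : forall q : 'I_5 * 'I_5, q.1 != q.2 -> forall r s : R,
      r \in `[0, 1] -> s \in `[0, 1] ->
      `|r - s| < h -> `|arc q.1 q.2 r - arc q.1 q.2 s| < d / 2 / 2.
    by move=> x y; apply: (H (x, y)).
  near: h; apply: filter_forall => -[x y] /=.
  case: (boolP (x != y)) => [xy|nxy]; last first.
    by apply: nearW => k xy; case/negP: nxy.
  have := within_continuous_unif (cont x y xy) (divr_gt0 d20 (ltr0Sn R 1)).
  by apply: filterS => k H _; exact: H.
have [n nh] : exists n : nat, h^-1 < n.+1%:R.
  exists (Num.bound h^-1); apply: lt_trans (archi_boundP _) _.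
    by rewrite invr_ge0 ltW.
  by rewrite ltr_nat.
pose u i : R := i%:R / n.+1%:R.
have u01 i : (i <= n.+1)%N -> u i \in `[0, 1].
  move=> iN; rewrite in_itv /= /u divr_ge0 ?ler0n //=.
  by rewrite ler_pdivrMr ?ltr0n // mul1r ler_nat.
have uS i : `|u i - u i.+1| < h.
  rewrite distrC /u -mulrBl -natrB // subSnn mul1r ger0_norm ?invr_ge0 ?ler0n //.
  by rewrite invf_plt ?posrE ?ltr0n.
(* Labels of the points: [(x, x, _)] is the vertex [x], shared by all its edges, and [(x, y, i)]
   with [x != y] is sample [i] of the arc. The perturbation acts on labels. *)
pose I := ('I_5 * 'I_5 * 'I_n.+2)%type.
pose P (i : I) := if i.1.1 == i.1.2 then pt (f i.1.1) else arc i.1.1 i.1.2 (u i.2).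
have d40 : 0 < d / 2 / 2 by rewrite divr_gt0.
have [Q PQ Qgen] := generic_perturbation P d40.
pose p x y i : I := if i == 0%N then (x, x, ord0)
                    else if i == n.+1 then (y, y, ord0) else (x, y, inord i).
have Pp x y i : x != y -> (i <= n.+1)%N -> P (p x y i) = arc x y (u i).
  move=> xy iN; have [_ _ a0 a1 _] := arcP _ _ (ef _ _ xy).
  rewrite /p /P; case: (i =P 0%N) => [->|/eqP i0].
    by rewrite /= eqxx /u mul0r /arc a0.
  case: (i =P n.+1) => [->|/eqP iN1].
    by rewrite /= eqxx /u divff ?pnatr_eq0 // /arc a1.
  by rewrite /= (negPf xy) inordK.
have p_inj x y : x != y -> {in [pred i | (i <= n.+1)%N] &, injective (p x y)}.
  (* [k] decodes the position along the polyline from the label. *)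
  move=> xy; pose k (q : I) : nat :=
    if q.1.1 == q.1.2 then if q.1.1 == x then 0 else n.+1 else q.2.
  apply: (can_in_inj (g := k)) => i; rewrite inE => iN; rewrite /k /p.
  case: (i =P 0%N) => [->|_]; first by rewrite /= !eqxx.
  case: (i =P n.+1) => [->|_]; last by rewrite /= (negPf xy) inordK.
  by rewrite /= eqxx eq_sym (negPf xy).
have p_disj x y z t i j : uniq [:: x; y; z; t] -> p x y i != p z t j.
  rewrite /= !inE !negb_or => /and4P[/and3P[xy xz xt] /andP[yz yt] zt _].
  apply/eqP => /(congr1 (fun q : I => q.1.1)); rewrite /p.
  by case: ifP => _; [|case: ifP => _] => /=;
    (case: ifP => _; [|case: ifP => _]) => /= /eqP; apply/negP.
have oP := chirotope_det3 Qgen.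
apply: (@K5_polylines_cross I _ n (fun x => (x, x, ord0)) p oP) => //.
- by move=> x y [].
- by move=> x y; rewrite /p eqxx.
- by move=> x y z t i j q _ _; apply: p_disj.
move=> x y z t i j q iN jN; apply/negP.
have [xy zt] : x != y /\ z != t.
  by move: q; rewrite /= !inE !negb_or => /and4P[/and3P[-> _ _] _ ->].
have pS a b k : a != b -> (k <= n)%N -> p a b k != p a b k.+1.
  by move=> ab kN; rewrite (inj_in_eq (p_inj a b ab)) ?inE ?neq_ltn ?ltnSn // leqW.
have q' : uniq [:: z; t; x; y] by rewrite (uniq_catC [:: z; t] [:: x; y]).
have det_neq0 a b c l k m : uniq [:: a; b; c; l] -> (k <= n)%N ->
    det3 (Q (p a b k)) (Q (p a b k.+1)) (Q (p c l m)) != 0.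
  move=> abcl kN; apply: Qgen.
  have ab : a != b by move: abcl; rewrite /= !inE !negb_or => /and4P[/and3P[]].
  by rewrite /= !inE negb_or (pS _ _ _ ab kN) !(p_disj _ _ _ _ _ _ abcl).
(* A crossing makes two perturbed segments share a point. That point is within [d / 2] of both arcs,
   [d / 2 / 2] each for mesh and perturbation, which contradicts [sep]. *)
rewrite /crosses !addb_gt0 ?det_neq0 // => /andP[/segments_meet/[apply]].
move=> [r [s [r01 s01 meet]]].
have near_arc a b k c : a != b -> (k <= n)%N -> 0 <= c <= 1 ->
    `|arc a b (u k) - affine (Q (p a b k)) (Q (p a b k.+1)) c| < d / 2.
  move=> ab kN c01; apply: affine_near => //.
    have := PQ (p a b k); rewrite Pp ?leqW // => /lt_trans; apply.
    by rewrite ltr_pdivrMr // ltr_pMr // ltr1n.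
  apply: (@distm_lt_split R (R * R)%type (arc a b (u k.+1))).
    exact: unif ab _ _ (u01 k (leqW kN)) (u01 k.+1 kN) (uS k).
  by have := PQ (p a b k.+1); rewrite Pp.
have := near_arc z t j s zt jN s01; rewrite -meet distrC.
move=> /(@distm_lt_split R (R * R)%type _ _ _ _ (near_arc x y i r xy iN r01)).
by rewrite ltNge sep // u01 // leqW.
Unshelve. all: by end_near. Qed.

End K5Drawing.

(** * Subalgebras of sl_2 *)

Section Sl2.
Local Open Scope ring_scope.
Variable F : finFieldType.
Hypothesis two_neq0 : 2 != 0 :> F.
Implicit Types (a b c t : F) (o : option F) (u v w : 'M[F]_2).

Definition sl2_mx a b c : 'M[F]_2 :=
  \matrix_(i, j) if i == 0 then if j == 0 then a else b
                 else if j == 0 then c else - a.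

Lemma eq_mx2 u v : u 0 0 = v 0 0 -> u 0 1 = v 0 1 -> u 1 0 = v 1 0 ->
  u 1 1 = v 1 1 -> u = v.
Proof.
move=> h00 h01 h10 h11; apply/matrixP => i j.
have ord2 (k : 'I_2) : k = 0 \/ k = 1.
  by case: k => -[|[|//]] p; [left | right]; apply/val_inj.
by case: (ord2 i) => ->; case: (ord2 j) => ->.
Qed.

Lemma mxtrace2 u : \tr u = u 0 0 + u 1 1.
Proof.
rewrite /mxtrace !big_ord_recl big_ord0 addr0.
by congr (_ + u _ _); apply/val_inj.
Qed.

Lemma mul_mx2 u v i j : (u *m v) i j = u i 0 * v 0 j + u i 1 * v 1 j.
Proof.
rewrite !mxE !big_ord_recl big_ord0 addr0.
by congr (_ + u _ _ * v _ _); apply/val_inj.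
Qed.

Lemma sl2_mxP u : reflect (exists a b c, u = sl2_mx a b c) (u \in sl F 2).
Proof.
rewrite mem_sl mxtrace2; apply: (iffP eqP) => [tr0|[a [b [c ->]]]]; last first.
  by rewrite !mxE subrr.
exists (u 0 0), (u 0 1), (u 1 0); apply: eq_mx2; rewrite !mxE //=.
by apply/eqP; rewrite -addr_eq0 addrC tr0.
Qed.

Lemma sl2_mx_inj a b c a' b' c' : sl2_mx a b c = sl2_mx a' b' c' ->
  [/\ a = a', b = b' & c = c'].
Proof.
move=> /matrixP E; have := E 0 0; have := E 0 1; have := E 1 0.
by rewrite !mxE.
Qed.

Lemma sl2_mx0 : sl2_mx 0 0 0 = 0.
Proof. by apply: eq_mx2; rewrite !mxE //= oppr0. Qed.

Lemma sl2_mx_eq0 a b c :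
  (sl2_mx a b c == 0) = [&& a == 0, b == 0 & c == 0].
Proof.
apply/eqP/and3P => [|[/eqP-> /eqP-> /eqP->]]; last exact: sl2_mx0.
by rewrite -sl2_mx0 => /sl2_mx_inj[-> -> ->].
Qed.

Lemma scale_sl2_mx t a b c : t *: sl2_mx a b c = sl2_mx (t * a) (t * b) (t * c).
Proof. by apply: eq_mx2; rewrite !mxE //= mulrN. Qed.

Lemma add_sl2_mx a b c a' b' c' :
  sl2_mx a b c + sl2_mx a' b' c' = sl2_mx (a + a') (b + b') (c + c').
Proof. by apply: eq_mx2; rewrite !mxE //= opprD. Qed.

Lemma bracket_sl2_mx a b c a' b' c' :
  lie_bracket (sl2_mx a b c) (sl2_mx a' b' c') =
  sl2_mx (b * c' - b' * c) (2 * (a * b' - a' * b)) (2 * (c * a' - c' * a)).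
Proof.
have sub u v i j : (u - v) i j = u i j - v i j by rewrite !mxE.
by apply: eq_mx2; rewrite /lie_bracket sub !mul_mx2 !mxE /=; ring.
Qed.

Lemma trace_sl2_mx a b c a' b' c' :
  \tr (sl2_mx a b c *m sl2_mx a' b' c') = 2 * (a * a') + b * c' + c * b'.
Proof. by rewrite mxtrace2 !mul_mx2 !mxE /=; ring. Qed.

Lemma root_char_sl2_mx a b c t :
  root (char_poly (sl2_mx a b c)) t = (t ^+ 2 == a ^+ 2 + b * c).
Proof.
have -> : char_poly (sl2_mx a b c) = 'X ^+ 2 - (a ^+ 2 + b * c)%:P.
  rewrite /char_poly (expand_det_row _ 0) !big_ord_recl big_ord0.
  rewrite /cofactor !det_mx11 !mxE /= expr0 expr1 addr0.
  ring.
by rewrite /root !hornerE subr_eq0.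
Qed.

(* Generators of the nilpotent lines, i.e. of the points of the projective conic
   a^2 + bc = 0. *)
Definition nil_mx o : 'M[F]_2 :=
  if o is Some t then sl2_mx t 1 (- t ^+ 2) else sl2_mx 0 0 1.

Definition borel o : {vspace 'M[F]_2} :=
  (sl F 2 :&: lker (linfun (mxtrace \o mulmx (nil_mx o) : 'M[F]_2 -> F^o)))%VS.

Lemma mem_borel o u : (u \in borel o) = (u \in sl F 2) && (\tr (nil_mx o *m u) == 0).
Proof. by rewrite memv_cap memv_ker lfunE. Qed.

Lemma borel_sl2_mx o a b c : (sl2_mx a b c \in borel o) =
  if o is Some t then 2 * (t * a) + c - t ^+ 2 * b == 0 else b == 0.
Proof.
rewrite mem_borel; have -> /= : sl2_mx a b c \in sl F 2.
  by apply/sl2_mxP; exists a, b, c.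
case: o => [t|] /=; rewrite trace_sl2_mx; congr (_ == _); ring.
Qed.

(** For finite parameters the trace form is [- (s - t) ^+ 2]: distinct points of the conic are never
    orthogonal. *)
Lemma nil_mx_borel o o' : (nil_mx o \in borel o') = (o == o').
Proof.
case: o => [s|]; rewrite borel_sl2_mx; case: o' => [t|] //=; rewrite ?eqxx ?oner_eq0 //.
  have -> : 2 * (t * s) - s ^+ 2 - t ^+ 2 * 1 = - (s - t) ^+ 2 by ring.
  by rewrite oppr_eq0 sqrf_eq0 subr_eq0; apply/eqP/eqP => [->|[]].
by rewrite mulr0 mulr0 add0r mulr0 subr0 oner_eq0.
Qed.

Lemma nil_mx_neq0 o : nil_mx o != 0.
Proof. by case: o => [t|]; rewrite sl2_mx_eq0 oner_eq0 ?andbF. Qed.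

Lemma line_subalgebra n (L : {vspace 'M[F]_n}) (u : 'M[F]_n) :
  u \in L -> lie_subalgebra L <[u]>.
Proof.
move=> uL; rewrite /lie_subalgebra -memvE uL.
apply/forallP => A; apply/forallP => B; apply/implyP => /vlineP[x ->].
apply/implyP => /vlineP[y ->]; rewrite /lie_bracket -!scalemxAl -!scalemxAr.
by rewrite !scalerA mulrC subrr mem0v.
Qed.

Lemma borel_subalgebra o : lie_subalgebra (sl F 2) (borel o).
Proof.
rewrite /lie_subalgebra capvSl; apply/forallP => A; apply/forallP => B.
apply/implyP => Ao; apply/implyP => Bo.
have /sl2_mxP[a [b [c EA]]] : A \in sl F 2 by move: Ao; rewrite mem_borel => /andP[].
have /sl2_mxP[a' [b' [c' EB]]] : B \in sl F 2 by move: Bo; rewrite mem_borel => /andP[].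
move: Ao Bo; rewrite EA EB bracket_sl2_mx !borel_sl2_mx.
case: o => [t|] /eqP Ao /eqP Bo; last by rewrite Ao Bo !mulr0 subrr mulr0.
have -> : c = t ^+ 2 * b - 2 * (t * a).
  by apply/eqP; rewrite -subr_eq0 -Ao; apply/eqP; ring.
have -> : c' = t ^+ 2 * b' - 2 * (t * a').
  by apply/eqP; rewrite -subr_eq0 -Bo; apply/eqP; ring.
by apply/eqP; ring.
Qed.

Lemma borel_neq0 o : borel o != 0%VS.
Proof.
apply: contraNneq (nil_mx_neq0 o) => b0.
by rewrite -memv0 -b0 nil_mx_borel.
Qed.

Definition nonsplit_mx u := [forall t, ~~ root (char_poly u) t].

(** Membership in [borel (Some s)] reads [b * s ^+ 2 - 2 * a * s - c = 0], and the substitution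
    [t = s * b - a] turns its roots into eigenvalues when [b != 0]. For [b = 0] the parameter is
    [None]. *)
Lemma nonsplitPn u : u \in sl F 2 ->
  reflect (exists o, u \in borel o) (~~ nonsplit_mx u).
Proof.
move=> /sl2_mxP uE; apply: (iffP idP); case: uE => a [b [c ->]];
  rewrite negb_forall; [move=> /existsP[t] | move=> [o uo]]; last first.
  apply/existsP; move: uo; rewrite borel_sl2_mx; case: o => [t /eqP|/eqP->]; last first.
    by exists a; rewrite negbK root_char_sl2_mx mul0r addr0.
  move=> E; exists (t * b - a); rewrite negbK root_char_sl2_mx.
  rewrite -subr_eq0 -[X in _ == X](mulr0 (- b)) -E; apply/eqP; ring.
rewrite negbK root_char_sl2_mx => /eqP tE.
have [b0|b0] := eqVneq b 0; first by exists None; rewrite borel_sl2_mx b0.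
exists (Some ((a + t) / b)); rewrite borel_sl2_mx; apply/eqP.
have -> : c = (t ^+ 2 - a ^+ 2) / b by rewrite tE; field.
by field.
Qed.

(** Up to factors 2 the bracket is the cross product of the coordinate vectors, which vanishes only
    on proportional ones. *)
Lemma comm_sl2_mx u v : u \in sl F 2 -> v \in sl F 2 -> u != 0 ->
  lie_bracket u v = 0 -> v \in <[u]>%VS.
Proof.
move=> /sl2_mxP[a [b [c ->]]] /sl2_mxP[a' [b' [c' ->]]].
rewrite bracket_sl2_mx => nz /eqP.
rewrite sl2_mx_eq0 !mulf_eq0 (negPf two_neq0) /= !subr_eq0.
move=> /and3P[/eqP E1 /eqP E2 /eqP E3]; apply/vlineP.
move: nz; rewrite sl2_mx_eq0 !negb_and => /or3P[a0|b0|c0].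
- have -> : b' = a' * b / a by rewrite -E2; field.
  have -> : c' = c * a' / a by rewrite E3; field.
  by exists (a' / a); rewrite scale_sl2_mx; congr sl2_mx; field.
- have -> : a' = a * b' / b by rewrite E2; field.
  have -> : c' = b' * c / b by rewrite -E1; field.
  by exists (b' / b); rewrite scale_sl2_mx; congr sl2_mx; field.
- have -> : a' = c' * a / c by rewrite -E3; field.
  have -> : b' = b * c' / c by rewrite E1; field.
  by exists (c' / c); rewrite scale_sl2_mx; congr sl2_mx; field.
Qed.

(** The form [\tr (lie_bracket u v *m w)] is alternating and trilinear, hence a multiple of the
    determinant on a space of dimension 3: this is Cramer's rule. *)
Lemma trace_bracket_cramer u v w x :
    u \in sl F 2 -> v \in sl F 2 -> w \in sl F 2 -> x \in sl F 2 ->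
  \tr (lie_bracket u v *m w) *: x = \tr (lie_bracket x v *m w) *: u
    + \tr (lie_bracket u x *m w) *: v + \tr (lie_bracket u v *m x) *: w.
Proof.
move=> /sl2_mxP[a [b [c ->]]] /sl2_mxP[a' [b' [c' ->]]].
move=> /sl2_mxP[a1 [b1 [c1 ->]]] /sl2_mxP[a2 [b2 [c2 ->]]].
rewrite !bracket_sl2_mx !trace_sl2_mx !scale_sl2_mx !add_sl2_mx.
by congr sl2_mx; ring.
Qed.

Lemma isotropic_sl2_mx u : u \in sl F 2 -> u != 0 -> \tr (u *m u) = 0 ->
  exists o, exists2 k, k != 0 & u = k *: nil_mx o.
Proof.
move=> /sl2_mxP[a [b [c ->]]]; rewrite sl2_mx_eq0 trace_sl2_mx => nz.
have -> : 2 * (a * a) + b * c + c * b = 2 * (a ^+ 2 + b * c) by ring.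
move/eqP; rewrite mulf_eq0 (negPf two_neq0) /= addr_eq0 => /eqP E.
have [b0|b0] := eqVneq b 0.
  move: E nz; rewrite b0 mul0r oppr0 => /eqP; rewrite sqrf_eq0 => /eqP->.
  rewrite !eqxx /= => c0; exists None, c => //.
  by rewrite scale_sl2_mx !mulr0 mulr1.
exists (Some (a / b)), b => //; rewrite scale_sl2_mx mulr1.
congr sl2_mx; first by rewrite mulrC divfK.
have -> : (a / b) ^+ 2 = a ^+ 2 / b ^+ 2 by field.
by rewrite E; field.
Qed.

Lemma lie_subalgebraP n (L U : {vspace 'M[F]_n}) : lie_subalgebra L U ->
  (U <= L)%VS /\ {in U &, forall A B, lie_bracket A B \in U}.
Proof.
move=> /andP[UL /forallP br]; split=> // A B AU BU.
by have /forallP/(_ B)/implyP/(_ AU)/implyP/(_ BU) := br A.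
Qed.

Lemma proper_subalgebraP (U : {vspace 'M[F]_2}) :
    proper_subalgebra (sl F 2) U ->
  nonsplit_semisimple_line U \/ exists o, (U <= borel o)%VS.
Proof.
move=> /and3P[/lie_subalgebraP[UL brU] U0 UnL].
have sUL x : x \in U -> x \in sl F 2 by move/(subvP UL).
set u := vpick U; have uU : u \in U by apply: memv_pick.
have u0 : u != 0 by rewrite vpick0.
have [Eu|] := boolP (U <= <[u]>)%VS.
  have {}Eu : U = <[u]>%VS by apply/eqP; rewrite eqEsubv Eu -memvE.
  have [nsu|/(nonsplitPn (sUL _ uU))[o uo]] := boolP (nonsplit_mx u).
    by left; apply/existsP; exists u; rewrite u0 {1}Eu eqxx.
  by right; exists o; rewrite Eu -memvE.
move=> /subvPn[v vU vNu].
have D0 w : w \in U -> \tr (lie_bracket u v *m w) = 0.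
  move=> wU; apply: contraNeq UnL => Dw; rewrite eqEsubv UL; apply/subvP => x xL.
  rewrite -(scalerK Dw x) memvZ //.
  rewrite (trace_bracket_cramer (sUL _ uU) (sUL _ vU) (sUL _ wU) xL).
  by rewrite !memvD ?memvZ.
have n0 : lie_bracket u v != 0.
  by apply: contraNneq vNu => /(comm_sl2_mx (sUL _ uU) (sUL _ vU) u0).
have nU := brU _ _ uU vU.
(* [D0] is used twice: at the bracket itself it gives isotropy, and at any [w] in [U] it gives
   orthogonality to the bracket. *)
have [o [k k0 Ek]] := isotropic_sl2_mx (sUL _ nU) n0 (D0 _ nU).
right; exists o; apply/subvP => w wU; rewrite mem_borel sUL //=.
by have /eqP := D0 w wU; rewrite Ek -scalemxAl mxtraceZ mulf_eq0 (negPf k0).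
Qed.

End Sl2.

(** * Squares in finite fields of odd order *)

Section FiniteFields.
Local Open Scope ring_scope.

(** If 2 vanished, the additive group would be a 2-group of odd order, hence trivial. *)
Lemma odd_card_two_neq0 (F : finFieldType) : odd #|F| -> 2 != 0 :> F.
Proof.
move=> oddF; apply/eqP => two0.
have char2 : 2%N \in [pchar F] by rewrite inE /= two0.
have F2 : 2%N.-nat #|F|.
  by have := abelem_pgroup (fin_ring_pchar_abelem char2); rewrite /pgroup cardsT.
have F1 : #|F| = 1%N by apply: pnat_1 F2 _; rewrite -odd_2'nat.
by have := finNzRing_gt1 F; rewrite F1.
Qed.

Variable F : finFieldType.
Hypothesis two_neq0 : 2 != 0 :> F.

Definition nonsquares : {set F} := ~: [set x ^+ 2 | x in [set: F]].

(** Squaring is two-to-one on nonzero elements, so half of them are squares. *)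
Lemma card_nonsquares : (#|nonsquares|.*2.+1 = #|F|)%N.
Proof.
pose N : {set F} := [set~ 0]; pose f (x : F) := x ^+ 2.
have cN : (#|N|.+1 = #|F|)%N by rewrite cardsC1 prednK // (cardD1 0).
have fN : f @: N = [set x ^+ 2 | x in [set: F]] :\ 0.
  apply/setP => y; rewrite !inE; apply/imsetP/andP => [[x xN ->]|[y0 /imsetP[x _ E]]].
    by rewrite sqrf_eq0 imset_f // ; move: xN; rewrite !inE.
  by exists x => //; rewrite !inE; apply: contraNneq y0 => x0; rewrite E x0 expr0n.
have double : (#|N| = #|f @: N|.*2)%N.
  rewrite -sum1_card (partition_big_imset f) /= -muln2 -sum_nat_const.
  apply: eq_bigr => y /imsetP[x]; rewrite !inE => x0 ->.
  rewrite sum1dep_card (_ : [set _ | _] = [set x; - x]).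
    by rewrite cards2 -addr_eq0 -mulr2n -mulr_natl mulf_eq0 negb_or two_neq0 x0.
  apply/setP => z; rewrite !inE /f eqf_sqr.
  rewrite andbC; case: orP => //= -[/eqP->|/eqP->]; first by rewrite x0.
  by rewrite oppr_eq0 x0.
have S0 : 0 \in [set x ^+ 2 | x in [set: F]].
  by apply/imsetP; exists 0; rewrite ?inE ?expr0n.
have := cardsC [set x ^+ 2 | x in [set: F]].
rewrite -/nonsquares (cardsD1 0 [set x ^+ 2 | x in [set: F]]) S0 -fN.
by rewrite -cN double add1n addSn -addnn => /succn_inj/addnI ->; rewrite addnn.
Qed.

End FiniteFields.

(** * The comaximal graph of sl_2 as a block graph *)

Section Gamma.
Local Open Scope ring_scope.
Variable F : finFieldType.
Hypothesis two_neq0 : 2 != 0 :> F.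
Let Gamma := @comaximal F 2 (sl F 2).
Let vertex := comaximal_vertex (sl F 2).
Implicit Types (A B : vertex) (o : option F).

Definition block A o : bool := (val A <= borel o)%VS.

Lemma nil_mx_sl o : nil_mx o \in sl F 2.
Proof.
have : nil_mx o \in borel o by rewrite nil_mx_borel.
by rewrite mem_borel => /andP[].
Qed.

Lemma sub_borel_neq_sl (U : {vspace 'M[F]_2}) o : (U <= borel o)%VS -> U != sl F 2.
Proof.
move=> Uo; apply: contraTneq Uo => ->; apply/subvPn.
exists (nil_mx (if o is Some _ then None else Some 0)); first exact: nil_mx_sl.
by rewrite nil_mx_borel; case: o.
Qed.

Lemma line_proper (u : 'M[F]_2) :
  u \in sl F 2 -> u != 0 -> proper_subalgebra (sl F 2) <[u]>.
Proof.
move=> usl u0; apply/and3P; split; first exact: line_subalgebra.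
  by rewrite -dimv_eq0 dim_vline u0.
(* If the line were everything, the nilpotents of parameters [None] and [Some 0] would be
   proportional. *)
apply: contraTneq (nil_mx_sl None) => E; apply/negP => n0.
have := nil_mx_sl (Some 0); rewrite -E => /vlineP[y Ey].
move: n0; rewrite -E => /vlineP[x Ex].
have /eqP : y *: nil_mx None = x *: nil_mx (Some 0) by rewrite Ex Ey !scalerA mulrC.
rewrite !scale_sl2_mx -subr_eq0 => /eqP/matrixP/(_ 0 1).
rewrite !mxE /= mulr0 mulr1 sub0r => /eqP; rewrite oppr_eq0 => /eqP x0.
by have := nil_mx_neq0 (None : option F); rewrite Ex x0 scale0r eqxx.
Qed.

Lemma borel_proper o : proper_subalgebra (sl F 2) (borel o).
Proof.
by rewrite /proper_subalgebra borel_subalgebra borel_neq0 (sub_borel_neq_sl (subvv _)).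
Qed.

Definition nil_line o : vertex :=
  Sub <[nil_mx o]>%VS (line_proper (nil_mx_sl o) (nil_mx_neq0 o)).
Definition borel_vertex o : vertex := Sub (borel o) (borel_proper o).

Lemma block_nil_line o o' : block (nil_line o) o' = (o == o').
Proof. by rewrite /block /= -memvE nil_mx_borel. Qed.

Lemma block_borel o : block (borel_vertex o) o.
Proof. exact: subvv. Qed.

Lemma borel_nil_line o : borel_vertex o != nil_line o.
Proof.
apply/eqP => /(congr1 val) /= E.
have [v vo] : exists2 v, v \in borel o & v \notin <[nil_mx o]>%VS.
  (* The witness solves the equation of the Borel subalgebra with [a = 1] and [b = 0]. *)
  case: o {E} => [t|]; [exists (sl2_mx 1 0 (- (2 * t))) | exists (sl2_mx 1 0 0)];
    rewrite ?borel_sl2_mx; try by apply/eqP; ring.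
  - apply/vlineP => -[k]; rewrite scale_sl2_mx => /sl2_mx_inj[+ + _].
    by rewrite mulr1 => + k0; rewrite -k0 mul0r => /eqP; rewrite oner_eq0.
  - apply/vlineP => -[k]; rewrite scale_sl2_mx mulr0 => /sl2_mx_inj[/eqP + _ _].
    by rewrite oner_eq0.
by rewrite -E vo.
Qed.

Lemma nonsplit_block A :
  nonsplit_semisimple_line (val A) = [forall o, ~~ block A o].
Proof.
have Apr : proper_subalgebra (sl F 2) (val A) := valP A.
apply/idP/forallP => [/existsP[u /and3P[u0 /eqP Au ns]] o|nb].
  rewrite /block Au -memvE; apply/negP => uo.
  have usl : u \in sl F 2 by move: uo; rewrite mem_borel => /andP[].
  have /(nonsplitPn usl) : exists o, u \in borel o by exists o.
  by rewrite /nonsplit_mx ns.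
have [//|[o Ao]] := proper_subalgebraP two_neq0 Apr.
by have := nb o; rewrite /block Ao.
Qed.

(** A common Borel contains the generated subalgebra. Conversely, a proper subalgebra containing [A]
    and [B] lies in a Borel or is a line, and in the latter case [A] and [B] both equal it. *)
Lemma comaximal_block A B :
  Gamma A B = (A != B) && [forall o, ~~ (block A o && block B o)].
Proof.
rewrite /Gamma /comaximal; have [->//|AB] /= := eqVneq A B.
have /and3P[/lie_subalgebraP[AL _] A0 _] : proper_subalgebra (sl F 2) (val A) := valP A.
have /and3P[/lie_subalgebraP[BL _] B0 _] : proper_subalgebra (sl F 2) (val B) := valP B.
apply/idP/forallP => [/eqP gen o|nb].
  apply/negP => /andP[Ao Bo]; have /negP := sub_borel_neq_sl (subvv (borel o)); apply.
  rewrite eqEsubv (lie_subalgebraP (borel_subalgebra o)).1 -[X in (X <= _)%VS]gen.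
  apply: (bigcapv_inf (borel o)); last exact: subvv.
  by apply/and3P; split=> //; exact: borel_subalgebra.
rewrite eqEsubv; apply/andP; split.
  by apply: (@bigcapv_inf _ _ _ (sl F 2)); rewrite ?subvv // sl_lie_subalgebra AL BL.
apply/subv_bigcapP => W /and3P[Wsub AW BW].
have [->|WL] := eqVneq W (sl F 2); first exact: subvv.
have W0 : W != 0%VS by apply: contraNneq A0 => W0; rewrite -subv0 -W0.
have Wpr : proper_subalgebra (sl F 2) W by apply/and3P.
have [/existsP[u /and3P[u0 /eqP Wu _]]|[o Wo]] := proper_subalgebraP two_neq0 Wpr.
  have eqW (U : {vspace 'M[F]_2}) : (U <= W)%VS -> U != 0%VS -> U = W.
    move=> UW U0; apply/eqP; rewrite eqEdim UW /=.
    by rewrite Wu dim_vline u0 lt0n dimv_eq0.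
  by case/eqP: AB; apply: val_inj; rewrite /= (eqW _ AW A0) (eqW _ BW B0).
by have := nb o; rewrite /block (subv_trans AW Wo) (subv_trans BW Wo).
Qed.

(** A nonsplit generator has [b != 0], else [a] is an eigenvalue, so it is normalised to [b = 1];
    the line is then given by [a] and the nonsquare [a ^+ 2 + c]. *)
Lemma card_nonsplit :
  #|[set A : vertex | nonsplit_semisimple_line (val A)]| = (#|F| * #|nonsquares F|)%N.
Proof.
pose f (x : F * F) : {vspace 'M[F]_2} := <[sl2_mx x.1 1%R (x.2 - x.1 ^+ 2)%R]>%VS.
have f_inj : injective f.
  move=> [a d] [a' d'] /eqP; rewrite /f eqEsubv -memvE /= => /andP[/vlineP[k] + _].
  rewrite scale_sl2_mx => /sl2_mx_inj[Ea Eb Ec]; move: Eb Ea Ec.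
  by rewrite mulr1 => <-; rewrite !mul1r => -> /addIr ->.
rewrite -cardsT -cardsX -(card_imset _ f_inj) -(card_imset _ val_inj).
apply: eq_card => U; apply/imsetP/imsetP => [[A]|[[a d]]].
  rewrite inE => /existsP[u /and3P[u0 /eqP Au /forallP ns]] ->.
  have /and3P[/lie_subalgebraP[AL _] _ _] : proper_subalgebra (sl F 2) (val A).
    exact: (valP A).
  have /sl2_mxP[a [b [c uE]]] : u \in sl F 2 by move: AL; rewrite Au -memvE.
  move: u0 Au ns; rewrite {u}uE => u0 Au ns.
  have b0 : b != 0.
    apply: contraTneq (ns a) => ->.
    by rewrite negbK root_char_sl2_mx mul0r addr0.
  exists (a / b, (a ^+ 2 + b * c) / b ^+ 2).
    rewrite !inE /=; apply/imsetP => -[x _ E].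
    have /negP := ns (x * b); apply; rewrite root_char_sl2_mx exprMn -E.
    by rewrite divfK // expf_neq0.
  rewrite Au /f /=.
  have -> : (a ^+ 2 + b * c) / b ^+ 2 - (a / b) ^+ 2 = c / b by field.
  have {1}-> : sl2_mx a b c = b *: sl2_mx (a / b) 1 (c / b).
    by rewrite scale_sl2_mx; congr sl2_mx; field.
  apply/eqP; rewrite eqEsubv -!memvE memvZ ?memv_line //=.
  by rewrite -[X in X \in _](scalerK b0) memvZ ?memv_line.
rewrite !inE /= => dns ->.
have usl : sl2_mx a 1 (d - a ^+ 2) \in sl F 2 by apply/sl2_mxP; do 3 eexists.
have u0 : sl2_mx a 1 (d - a ^+ 2) != 0 by rewrite sl2_mx_eq0 oner_eq0 andbF.
exists (Sub (f (a, d)) (line_proper usl u0)) => //.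
rewrite inE; apply/existsP; exists (sl2_mx a 1 (d - a ^+ 2)).
rewrite u0 eqxx /=; apply/forallP => t; rewrite root_char_sl2_mx mul1r addrC subrK.
by apply: contraNneq dns => <-; apply: imset_f.
Qed.
End Gamma.

Theorem corollary4p16 (R : realType) (F : finFieldType) (q : nat)
    (hq : #|F| = q) (q_odd : odd q) :
  let Gamma := @comaximal F 2 (sl F 2) in
  [/\ graph_connected Gamma,
      graph_girth Gamma = 3,
      clique_number Gamma = (q ^ 2 + q + 2) %/ 2,
      graph_diameter Gamma = 2 &
      domination_number Gamma = 1] /\
  [/\ forall A, on_triangle Gamma A,
      ~ planar Gamma R,
      graph_radius Gamma = 1 &
      graph_center Gamma =
        [set A : comaximal_vertex (sl F 2) |
          nonsplit_semisimple_line (val A)]%SET].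
Proof.
move=> Gamma; have two0 : (2 != 0 :> F)%R by apply: odd_card_two_neq0; rewrite hq.
have free : free_vertices (@block F) =
    [set A : comaximal_vertex (sl F 2) | nonsplit_semisimple_line (val A)]%SET.
  by apply/setP => A; rewrite !inE nonsplit_block.
have := card_nonsquares two0; rewrite hq; set m := #|nonsquares F| => Em.
have cfree : #|free_vertices (@block F)| = q * m by rewrite free card_nonsplit ?hq.
have cK : #|{: option F}| = q.+1 by rewrite card_option hq.
have m0 : 0 < m.
  have := finNzRing_gt1 F; rewrite hq -Em; by case: (m).
have q2 : 2 < q by rewrite -Em ltnS (leq_double 1).
have free2 : 1 < #|free_vertices (@block F)|.
  by rewrite cfree (leq_trans (ltnW q2)) // leq_pmulr.
have K2 : 1 < #|{: option F}| by rewrite cK ltnS (leq_trans _ q2).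
have adj := comaximal_block two0.
have pt_inc := @block_nil_line F; have blk_inc := @block_borel F.
have blk_pt := @borel_nil_line F.
split; split.
- exact: (block_graph_connected adj).
- exact: (block_graph_girth adj pt_inc).
- rewrite (block_graph_clique adj pt_inc) // cfree cK.
  (* Here [q = 2 * m + 1], with [q * m] nonsplit lines and [q.+1] nilpotent ones. *)
  have -> : q ^ 2 + q + 2 = (q * m + q.+1) * 2.
    by rewrite -Em -mulnn -addnn; ring.
  by rewrite mulnK.
- exact: (block_graph_diameter adj pt_inc blk_inc blk_pt).
- exact: (block_graph_domination adj pt_inc).
- exact: (block_graph_triangle adj pt_inc).
- have clq := free_pts_clique adj pt_inc.
  (* Two nonsplit and three nilpotent lines already give a K_5. *)
  have S5 : 4 < #|free_vertices (@block F) :|: (@nil_line F) @: [set: option F]|.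
    rewrite (card_free_pts pt_inc) cK -[5]/(2 + 3).
    by apply: leq_add; rewrite // ltnS ltnW.
  have [f inj_f ef] := clique_embedding clq S5.
  exact: K5_not_planar inj_f ef.
- exact: (block_graph_radius adj pt_inc blk_inc blk_pt).
- by rewrite (block_graph_center adj pt_inc blk_inc blk_pt).
Qed.
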